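(* Let $f=(f_n)_{n\in\mathbb{N}}$ be a computable ensemble of functions $f_n:\{0,1\}^n\times\{0,1\}^n\to\{0,1\}^{m}$, where $m=m(n)$. Then for every $n$ and every $\alpha\in\mathbb{N}$ with $\alpha\le m$ there exists a pair of strings $x\in\{0,1\}^n$, $y\in\{0,1\}^n$ such that $$C(x\mid y)\ge n-\alpha-2\log n,\qquad C(y\mid x)\ge n-\alpha-2\log n,\qquad C(f_n(x,y))\le m-\alpha+\log n+2\log\alpha+O(1),$$ where the $O(1)$ term is a constant that does not depend on $n$, $\alpha$, $x$, $y$.
   Context: $C(\cdot)$ denotes plain Kolmogorov complexity with respect to a fixed universal Turing machine $U$, and $C(x\mid y)$ denotes plain conditional Kolmogorov complexity of $x$ given $y$ with respect to a fixed universal conditional machine. All logarithms are base 2. *)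

(* Defs.v *)
From HB Require Import structures.
From mathcomp Require Import all_boot all_order all_algebra.
From mathcomp Require Import boolp reals exp.

Set Implicit Arguments.
Unset Strict Implicit.
Unset Printing Implicit Defensive.

Import Order.TTheory GRing.Theory Num.Theory.

Definition string := seq bool.

(* The model of computation: Kleene's partial recursive functions, of type
   N^k -> N for a code of type [code k]. *)
Inductive code : nat -> Type :=
| Zero k : code k
| Succ : code 1
| Proj k (i : 'I_k) : code k
| Comp k l (g : code l) (h : 'I_l -> code k) : code k
| PRec k (g : code k) (h : code k.+2) : code k.+1
| Mu k (g : code k.+1) : code k.

(* [eval c v r]: the computation of [c] on the arguments [v] halts with
   value [r].  In the primitive recursion clause [s] is the sequence of
   intermediate values; in the minimisation clause [g] must be defined (and
   nonzero) at all arguments smaller than the result. *)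
Fixpoint eval k (c : code k) : k.-tuple nat -> nat -> Prop :=
  match c in code k0 return k0.-tuple nat -> nat -> Prop with
  | Zero _ => fun _ r => r = 0
  | Succ => fun v r => r = (thead v).+1
  | Proj _ i => fun v r => r = tnth v i
  | Comp _ l g h => fun v r =>
      exists w : l.-tuple nat,
        (forall i, eval (h i) v (tnth w i)) /\ eval g w r
  | PRec _ g h => fun v r =>
      let a := [tuple of behead v] in
      exists s : nat -> nat,
        [/\ eval g a (s 0),
            forall i, i < thead v -> eval h [tuple of i :: s i :: a] (s i.+1)
          & r = s (thead v)]
  | Mu _ g => fun v r =>
      eval g [tuple of r :: v] 0 /\
      forall i, i < r -> exists z, eval g [tuple of i :: v] z.+1
  end.

Lemma eval_det k (c : code k) (v : k.-tuple nat) (r r' : nat) :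
  eval c v r -> eval c v r' -> r = r'.
Proof.
elim: c v r r' => {k} [k|| k i|k l g IHg h IHh|k g IHg h IHh|k g IHg] v r r' /=.
- by move=> -> ->.
- by move=> -> ->.
- by move=> -> ->.
- move=> [w [hw gw]] [w' [hw' gw']].
  have ww' : w = w' by apply: eq_from_tnth => i; apply: IHh (hw i) (hw' i).
  by rewrite ww' in gw; apply: IHg gw gw'.
- move=> [s [s0 sS ->]] [s' [s0' sS' ->]].
  have ss' i : i <= thead v -> s i = s' i.
    elim: i => [_|i IHi lt_iv]; first exact: IHg s0 s0'.
    have := sS' _ lt_iv; rewrite -(IHi (ltnW lt_iv)).
    exact: IHh (sS _ lt_iv).
  exact: ss'.
move=> [gr0 grN] [gr0' grN'].
case: (ltngtP r r') => // [/grN'|/grN] [z gz].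
  by have := IHg _ _ _ gr0 gz.
by have := IHg _ _ _ gr0' gz.
Qed.

(* Bijective base-2 numeration, least significant digit first: a bijection
   between strings and natural numbers. *)
Definition nat_of_string (s : string) : nat :=
  foldr (fun (b : bool) k => b + k.*2.+1) 0 s.

Lemma nat_of_string_inj : injective nat_of_string.
Proof.
elim=> [|b s IHs] [|b' s'] //=; rewrite ?addnS // => -[e].
have eb : b = b' by case: b b' e => -[] // /(congr1 odd) /=; rewrite !odd_double.
by move: e; rewrite eb => /addnI /double_inj /IHs ->.
Qed.

Lemma nat_of_string_surj k : exists s, nat_of_string s = k.
Proof.
elim/ltn_ind: k => -[_|k IHk]; first by exists [::].
have [|s es] := IHk k./2; first by rewrite ltnS -divn2 leq_div.
by exists (odd k :: s); rewrite /= es addnS odd_double_half.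
Qed.

Definition partial_computable (M : string -> option string) : Prop :=
  exists c : code 1, forall p x : string,
    M p = Some x <-> eval c [tuple nat_of_string p] (nat_of_string x).

Definition partial_computable2 (M : string -> string -> option string) : Prop :=
  exists c : code 2, forall p y x : string,
    M p y = Some x <->
    eval c [tuple nat_of_string p; nat_of_string y] (nat_of_string x).

(* Universality is meant in the sense needed for Kolmogorov complexity: any
   other machine is simulated with at most a constant increase of the program
   length. *)
Record universal_machine := UniversalMachine {
  run :> string -> option string;
  run_computable : partial_computable run;
  run_universal : forall M : string -> option string, partial_computable M ->
    exists c : nat, forall p x : string, M p = Some x ->
      exists q : string, run q = Some x /\ size q <= size p + c }.

(* The first argument of a conditional machine is the program and the second
   one is the condition. *)
Record universal_cond_machine := UniversalCondMachine {
  crun :> string -> string -> option string;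
  crun_computable : partial_computable2 crun;
  crun_universal : forall M : string -> string -> option string,
    partial_computable2 M ->
    exists c : nat, forall p y x : string, M p y = Some x ->
      exists q : string, crun q y = Some x /\ size q <= size p + c }.

Lemma has_program (U : universal_machine) (x : string) :
  exists k, `[< exists p, U p = Some x /\ size p = k >].
Proof.
have [|c Uc] := @run_universal U Some.
  exists (Proj ord0) => p z /=; split=> [[->] //|].
  by move=> /nat_of_string_inj ->.
by have [q [Uq _]] := Uc x x erefl; exists (size q); apply/asboolP; exists q.
Qed.

Lemma has_cond_program (V : universal_cond_machine) (x y : string) :
  exists k, `[< exists p, V p y = Some x /\ size p = k >].
Proof.
have [|c Vc] := @crun_universal V (fun p _ => Some p).
  exists (Proj ord0) => p y' z /=; split=> [[->] //|].
  by move=> /nat_of_string_inj ->.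
by have [q [Vq _]] := Vc x y x erefl; exists (size q); apply/asboolP; exists q.
Qed.

Definition C (U : universal_machine) (x : string) : nat :=
  ex_minn (has_program U x).

(* C(x | y): the object described comes first, the condition second. *)
Definition Ccond (V : universal_cond_machine) (x y : string) : nat :=
  ex_minn (has_cond_program V x y).

(* No condition is put on the code outside of the domain |x| = |y| = n.
   Computability of m follows, since m n is the length of f_n(x, y). *)
Definition computable_ensemble (m : nat -> nat)
    (f : forall n, n.-tuple bool -> n.-tuple bool -> (m n).-tuple bool) : Prop :=
  exists c : code 3, forall n (x y : n.-tuple bool),
    eval c [tuple n; nat_of_string x; nat_of_string y]
      (nat_of_string (f n x y)).

Local Open Scope ring_scope.

(* Since [ln 0 = 0], this fixes the convention log 0 = 0. *)
Definition log2 (R : realType) (n : nat) : R := ln n%:R / ln 2.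

(* Main.v *)
Require Import Defs.
From mathcomp Require Import all_boot all_order all_algebra.
From mathcomp Require Import boolp reals exp.
From mathcomp Require Import zify lra.

(* Order the values of f_n by decreasing number of preimages.  The 2^(m-alpha)
   most popular values have at least 2^(2n-alpha)/2 preimages, whereas at most
   4*2^(2n-alpha)/n^2 pairs violate one of the two lower bounds; so for n >= 3
   some independent pair (x, y) has a popular value f_n(x, y).  That value is
   determined by n and its rank i < 2^(m-alpha).  No description of alpha is
   needed: making n self-delimiting costs 2 log log n bits, which is at most
   2 log alpha when alpha >= log n, and when alpha <= log n the upper bound on
   C(f_n(x, y)) holds trivially. *)

Set Implicit Arguments.
Unset Strict Implicit.
Unset Printing Implicit Defensive.

(** * Total computable functions *)

Definition var i (v : seq nat) := nth 0 v i.

Arguments var : simpl never.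

(** Arguments come as lists so that functions compose without dependent types; only lists of length
    [k] matter. *)
Definition computable k (F : seq nat -> nat) :=
  exists c : code k, forall v : k.-tuple nat, eval c v (F v).

Lemma eq_computable k (F G : seq nat -> nat) :
  (forall v, size v = k -> F v = G v) -> computable k F -> computable k G.
Proof.
by move=> eFG [c cF]; exists c => v; rewrite -eFG ?size_tuple.
Qed.

(** Stated for runs of an arbitrary code [g], because the code of an ensemble is specified only on
    strings of length [n]. *)
Lemma eval_comp k l (g : code l) (Hs : seq (seq nat -> nat)) :
    size Hs = l ->
    (forall i, i < l -> computable k (nth (fun=> 0) Hs i)) ->
  exists c : code k, forall (v : k.-tuple nat) (w : l.-tuple nat) r,
    tval w = [seq H (tval v) | H <- Hs] -> eval g w r -> eval c v r.
Proof.
move=> szH cH.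
have [i|h hP] := @fin_all_exists 'I_l (fun=> code k)
    (fun i c => forall v : k.-tuple nat, eval c v (nth (fun=> 0) Hs i v)).
  exact: cH.
exists (Comp g h) => v w r ew gr /=; exists w; split=> // i.
by rewrite (tnth_nth 0) ew (nth_map (fun=> 0)) ?szH.
Qed.

Lemma computable_comp k l (G : seq nat -> nat) (Hs : seq (seq nat -> nat)) :
    computable l G -> size Hs = l ->
    (forall i, i < l -> computable k (nth (fun=> 0) Hs i)) ->
  computable k (fun v => G [seq H v | H <- Hs]).
Proof.
move=> [g gG] szH cH; have [c cP] := eval_comp g szH cH; exists c => v.
have szw : size [seq H (tval v) | H <- Hs] == l by rewrite size_map szH.
exact: (cP v (Tuple szw) _ erefl (gG (Tuple szw))).
Qed.

Lemma computable_var k i : i < k -> computable k (var i).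
Proof.
by move=> ik; exists (Proj (Ordinal ik)) => v /=; rewrite (tnth_nth 0).
Qed.

(** Substitutes a computed value for the first argument, the one on which [PRec] recurses. *)
Lemma computable_cons k (F B : seq nat -> nat) :
  computable k.+1 F -> computable k B -> computable k (fun v => F (B v :: v)).
Proof.
move=> cF cB; pose Hs := B :: [seq var i | i <- iota 0 k].
apply: (@eq_computable _ (fun v => F [seq H v | H <- Hs])) => [v szv|].
  have ev : [seq var i v | i <- iota 0 k] = v.
    by rewrite -szv; apply: mkseq_nth.
  by rewrite /= -map_comp /comp ev.
apply: (computable_comp cF); first by rewrite /= size_map size_iota.
case=> // i ik /=; rewrite (nth_map 0) ?size_iota // nth_iota //.
exact: computable_var.
Qed.

Lemma computable_behead k (F : seq nat -> nat) :
  computable k F -> computable k.+1 (fun v => F (behead v)).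
Proof.
move=> cF; pose Hs := [seq var i | i <- iota 1 k].
apply: (@eq_computable _ (fun v => F [seq H v | H <- Hs])) => [v szv|].
  rewrite /= -map_comp /comp /var map_nth_iota ?szv ?subn1 //.
  by rewrite drop1 take_oversize // size_behead szv.
apply: (computable_comp cF); first by rewrite size_map size_iota.
move=> i ik; rewrite (nth_map 0) ?size_iota // nth_iota //.
exact: computable_var.
Qed.

Lemma computable_var_behead2 k i : i.+2 < k ->
  computable k (fun v => var i (behead (behead v))).
Proof.
case: k => [|[|k]] // ik;
  apply: (@computable_behead k.+1 (fun v => var i (behead v))).
exact/(@computable_behead k)/computable_var.
Qed.

(** The skipped argument is the accumulator that [PRec] hands to its step function; a summand does
    not depend on it. *)
Lemma computable_skip1 k (F : nat -> seq nat -> nat) :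
  computable k.+1 (fun v => F (var 0 v) (behead v)) ->
  computable k.+2 (fun v => F (var 0 v) (behead (behead v))).
Proof.
move=> cF; pose Hs := var 0 :: [seq var i | i <- iota 2 k].
apply: (@eq_computable _ (fun v => (fun w => F (var 0 w) (behead w))
    [seq H v | H <- Hs])) => [v szv|].
  rewrite /= -map_comp /comp /var map_nth_iota ?szv ?subn2 // take_oversize.
    by case: v szv => // a [|b v] //; rewrite /= drop0.
  by rewrite size_drop szv subn2.
apply: (computable_comp cF); first by rewrite /= size_map size_iota.
case=> [|i] ik; first exact: computable_var.
rewrite /= (nth_map 0) ?size_iota // nth_iota //.
exact: computable_var.
Qed.

Lemma computable_rec k (G H : seq nat -> nat) (r : nat -> seq nat -> nat) :
    computable k G -> computable k.+2 H ->
    (forall a, r 0 a = G a) ->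
    (forall i a, r i.+1 a = H (i :: r i a :: a)) ->
  computable k.+1 (fun v => r (var 0 v) (behead v)).
Proof.
move=> [g gG] [h hH] r0 rS; exists (PRec g h) => v /=.
exists (fun i => r i (behead v)); split.
- by rewrite r0; apply: gG.
- by move=> i _; rewrite rS; apply: hH.
- by case/tupleP: v => a v.
Qed.

Lemma computable_succ k (A : seq nat -> nat) :
  computable k A -> computable k (fun v => (A v).+1).
Proof.
move=> cA; apply: (@computable_comp _ 1 (fun w => (var 0 w).+1) [:: A]) => //.
  by exists Succ => v /=; case/tupleP: v.
by case.
Qed.

Lemma computable_const k a : computable k (fun=> a).
Proof.
elim: a => [|a IHa]; last exact: computable_succ.
by exists (Zero k).
Qed.

Lemma computable_app1 k (f : nat -> nat) (A : seq nat -> nat) :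
  computable 1 (fun w => f (var 0 w)) ->
  computable k A -> computable k (fun v => f (A v)).
Proof.
by move=> cf cA; apply: (computable_comp (Hs := [:: A]) cf) => // -[].
Qed.

Lemma computable_app2 k (f : nat -> nat -> nat) (A B : seq nat -> nat) :
  computable 2 (fun w => f (var 0 w) (var 1 w)) ->
  computable k A -> computable k B -> computable k (fun v => f (A v) (B v)).
Proof.
by move=> cf cA cB; apply: (computable_comp (Hs := [:: A; B]) cf) => // -[|[]].
Qed.

Lemma computable_app3 k (f : nat -> nat -> nat -> nat) (A B D : seq nat -> nat) :
  computable 3 (fun w => f (var 0 w) (var 1 w) (var 2 w)) ->
  computable k A -> computable k B -> computable k D ->
  computable k (fun v => f (A v) (B v) (D v)).
Proof.
move=> cf cA cB cD.
by apply: (computable_comp (Hs := [:: A; B; D]) cf) => // -[|[|[]]].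
Qed.

Lemma computable_add k (A B : seq nat -> nat) :
  computable k A -> computable k B -> computable k (fun v => A v + B v).
Proof.
apply: computable_app2.
apply: (@eq_computable _ (fun v => var 0 v + var 0 (behead v))).
  by move=> v _; rewrite /var nth_behead.
apply: (@computable_rec _ (var 0) (fun w => (var 1 w).+1)
  (fun i a => i + var 0 a)) => //; first exact: computable_var.
exact/computable_succ/computable_var.
Qed.

Lemma computable_sum k (B : seq nat -> nat) (G : nat -> seq nat -> nat) :
  computable k B -> computable k.+1 (fun w => G (var 0 w) (behead w)) ->
  computable k (fun v => \sum_(0 <= i < B v) G i v).
Proof.
move=> cB cG.
apply: (@computable_cons _ (fun w => \sum_(0 <= i < var 0 w) G i (behead w))) cB.
apply: (@computable_rec _ (fun=> 0)
  (fun w => var 1 w + G (var 0 w) (behead (behead w)))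
  (fun b a => \sum_(0 <= i < b) G i a)).
- exact: computable_const.
- apply: computable_add; first exact: computable_var.
  exact: computable_skip1.
- by move=> a; rewrite big_geq.
- by move=> i a; rewrite big_nat_recr //= addnC /= addnC.
Qed.

Lemma computable_mul k (A B : seq nat -> nat) :
  computable k A -> computable k B -> computable k (fun v => A v * B v).
Proof.
move=> cA cB; apply: (@eq_computable _ (fun v => \sum_(0 <= i < A v) B v)).
  by move=> v _; rewrite sum_nat_const_nat subn0.
by apply: (computable_sum (G := fun=> B)) => //; apply: computable_behead.
Qed.

Lemma computable_pred k (A : seq nat -> nat) :
  computable k A -> computable k (fun v => (A v).-1).
Proof.
apply: computable_app1.
apply: (@computable_rec _ (fun=> 0) (var 0) (fun i _ => i.-1)) => //.
  exact: computable_const.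
exact: computable_var.
Qed.

Lemma computable_sub k (A B : seq nat -> nat) :
  computable k A -> computable k B -> computable k (fun v => A v - B v).
Proof.
(* Recursion runs on the first argument, so the subtrahend is moved there. *)
move=> cA cB; apply: (computable_app2 (f := fun b a => a - b)) cB cA.
apply: (@eq_computable _ (fun v => var 0 (behead v) - var 0 v)).
  by move=> v _; rewrite /var nth_behead.
apply: (@computable_rec _ (var 0) (fun w => (var 1 w).-1)
  (fun i a => var 0 a - i)) => //.
- exact: computable_var.
- exact/computable_pred/computable_var.
- by move=> a; rewrite subn0.
- by move=> i a; rewrite subnS.
Qed.

Lemma computable_exp2 k (A : seq nat -> nat) :
  computable k A -> computable k (fun v => 2 ^ A v).
Proof.
apply: computable_app1.
apply: (@computable_rec _ (fun=> 1) (fun w => 2 * var 1 w) (fun i _ => 2 ^ i)).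
- exact: computable_const.
- by apply: computable_mul; [apply: computable_const|apply: computable_var].
- by [].
- by move=> i a; rewrite expnS.
Qed.

Lemma computable_leq k (A B : seq nat -> nat) :
  computable k A -> computable k B -> computable k (fun v => (A v <= B v) : nat).
Proof.
move=> cA cB; apply: (@eq_computable _ (fun v => 1 - (A v - B v))).
  by move=> v _; rewrite /leq; case: (A v - B v).
by do 2?[apply: computable_sub => //]; apply: computable_const.
Qed.

Lemma computable_eq k (A B : seq nat -> nat) :
  computable k A -> computable k B -> computable k (fun v => (A v == B v) : nat).
Proof.
move=> cA cB; apply: (@eq_computable _ (fun v => (A v <= B v) * (B v <= A v))).
  by move=> v _; rewrite eqn_leq mulnb.
by apply: computable_mul; apply: computable_leq.
Qed.

(** Counting the powers of 2 from 2 up to [n] turns the logarithm into a bounded sum; [n] terms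
    suffice, as the logarithm is at most [n]. *)
Lemma trunc_log2_sum n : trunc_log 2 n = \sum_(0 <= k < n) (2 ^ k.+1 <= n).
Proof.
case: n => [|n]; first by rewrite big_geq.
have [lo hi] := andP (trunc_log_bounds (isT : 1 < 2) (ltn0Sn n)).
set t := trunc_log 2 n.+1 in lo hi *.
have tn : t <= n.+1 by apply: leq_trans (ltnW (ltn_expl _ _)) lo.
have tE (k : nat) : (2 ^ k.+1 <= n.+1) = (k < t).
  apply/idP/idP => [le_k|kt]; last by apply: leq_trans lo; rewrite leq_exp2l.
  by rewrite -ltnS -(ltn_exp2l _ _ (isT : 1 < 2)) (leq_ltn_trans le_k).
under eq_big_nat => k _ do rewrite tE.
have sumE b : \sum_(0 <= k < b) (k < t) = minn b t.
  elim: b => [|b IHb]; first by rewrite big_geq ?min0n.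
  by rewrite big_nat_recr //= IHb; lia.
by rewrite sumE (minn_idPr tn).
Qed.

Ltac comp_step := first
  [ apply: computable_const | apply: computable_var; done
  | apply: computable_var_behead2; done
  | apply: computable_sum | apply: computable_add | apply: computable_sub
  | apply: computable_mul | apply: computable_leq | apply: computable_eq
  | apply: computable_succ | apply: computable_exp2 | apply: computable_behead ].

Lemma computable_trunc_log k (A : seq nat -> nat) :
  computable k A -> computable k (fun v => trunc_log 2 (A v)).
Proof.
apply: computable_app1.
apply: (@eq_computable _
    (fun v => \sum_(0 <= k < var 0 v) (2 ^ k.+1 <= var 0 v))).
  by move=> v _; rewrite trunc_log2_sum.
by repeat comp_step.
Qed.

(** * Pairing and ranking *)

(* Up to a constant factor the code is [n * (log n)^2 * (i + 1)]: the length [k]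
   of [n] is itself preceded by its length [l], given in unary by [2 ^ l]. *)
Definition pair_code n i :=
  let k := trunc_log 2 n in
  let l := trunc_log 2 k.+1 in
  let a := (i * 2 ^ k.+1 + n) * 2 ^ l.+1 + k.+1 in
  2 ^ l * (a + a).+1.

Lemma ltn_trunc_log2 n : n < 2 ^ (trunc_log 2 n).+1.
Proof. exact: trunc_log_ltn. Qed.

Lemma exp2_odd_inj l l' a a' :
  2 ^ l * (a + a).+1 = 2 ^ l' * (a' + a').+1 -> l = l' /\ a = a'.
Proof.
rewrite !addnn.
elim: l l' => [|l IHl] [|l']; rewrite ?expn0 ?mul1n ?expnS -?mulnA.
- by move=> [/double_inj].
- by move/(congr1 odd); rewrite /= odd_double mul2n odd_double.
- by move/(congr1 odd); rewrite /= odd_double mul2n odd_double.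
- by move/eqP; rewrite eqn_pmul2l // => /eqP/IHl[-> ->].
Qed.

Lemma divmod_inj d q q' r r' : r < d -> r' < d ->
  q * d + r = q' * d + r' -> q = q' /\ r = r'.
Proof.
move=> rd rd' e; have d0 : 0 < d by case: d rd {rd' e}.
move: (congr1 (divn^~ d) e) (congr1 (modn^~ d) e).
by rewrite !modnMDl !modn_small // !divnMDl // !divn_small // !addn0.
Qed.

(** The code is read from its low end: the exponent of 2 gives [l]; then, in [a], the lowest [l + 1]
    bits give [k + 1] and the next [k + 1] bits give [n]. *)
Lemma pair_code_inj n n' i i' :
  pair_code n i = pair_code n' i' -> n = n' /\ i = i'.
Proof.
rewrite /pair_code => /exp2_odd_inj[el].
rewrite el => /divmod_inj[||eb [ek]]; rewrite ?ltn_trunc_log2 //.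
  by rewrite -el ltn_trunc_log2.
move: eb; rewrite ek => /divmod_inj[||-> ->//]; last exact: ltn_trunc_log2.
by rewrite -ek ltn_trunc_log2.
Qed.

(** Bounds both searches in [decode_pair]. *)
Lemma leq_pair_code n i : n <= pair_code n i /\ i <= pair_code n i.
Proof.
rewrite /pair_code; set k := trunc_log 2 n; set l := trunc_log 2 k.+1.
have le_mul a x : a <= a * 2 ^ x by rewrite leq_pmulr // expn_gt0.
set b := i * _ + n; set a := b * _ + _.
have b_le : b <= 2 ^ l * (a + a).+1.
  apply: (@leq_trans (a + a).+1); last by rewrite mulnC le_mul.
  by have := le_mul b l.+1; rewrite /a; lia.
by split; apply: leq_trans b_le; have := le_mul i k.+1; rewrite /b; lia.
Qed.

Lemma pair_code_bound n i : 0 < n ->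
  (pair_code n i).+1 <= 8 * (trunc_log 2 n).+1 ^ 2 * n * i.+1.
Proof.
move=> n_gt0; have := trunc_logP (isT : 1 < 2) n_gt0.
have := trunc_logP (isT : 1 < 2) (ltn0Sn (trunc_log 2 n)).
have := ltn_trunc_log2 (trunc_log 2 n).+1; have := ltn_trunc_log2 n.
rewrite /pair_code; set k := trunc_log 2 n; set l := trunc_log 2 k.+1.
rewrite !expnS; set K := 2 ^ k; set L := 2 ^ l => nK kL Lk Kn.
set a := _ + k.+1.
(* Since [n < 2 * K] and [k + 1 < 2 * L], each remainder costs less than one unit of its
   quotient. *)
have a_lt : a.+1 <= 2 * L * (2 * K * i.+1).
  by rewrite /a; nia.
apply: (@leq_trans (2 * L * a.+1)); first by nia.
apply: (@leq_trans (2 * L * (2 * L * (2 * K * i.+1)))).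
  by rewrite leq_mul2l a_lt orbT.
rewrite expn0 muln1.
have -> : 2 * L * (2 * L * (2 * K * i.+1)) = 8 * (L * L) * K * i.+1 by lia.
by rewrite leq_mul2r /= leq_mul // leq_mul // leq_mul.
Qed.

(** A bounded search written as a sum: [pair_code] is injective, so at most one term survives. *)
Definition decode_pair (g : nat -> nat -> nat) N :=
  \sum_(0 <= n < N.+1) \sum_(0 <= i < N.+1) (pair_code n i == N) * g n i.

Lemma decode_pairE g n i : decode_pair g (pair_code n i) = g n i.
Proof.
have [ln li] := leq_pair_code n i; rewrite /decode_pair !big_mkord.
rewrite (bigD1 (Ordinal (ln : n < _.+1))) //= big_mkord.
rewrite (bigD1 (Ordinal (li : i < _.+1))) //= eqxx mul1n.
rewrite big1 ?addn0 => [|j ne_j]; last first.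
  case: eqP => // /pair_code_inj[_ ej].
  by rewrite -val_eqE /= ej eqxx in ne_j.
rewrite big1 ?addn0 // => j ne_j; rewrite big_mkord big1 // => j' _.
case: eqP => // /pair_code_inj[ej _].
by rewrite -val_eqE /= ej eqxx in ne_j.
Qed.

Lemma computable_pair_code k (A B : seq nat -> nat) :
  computable k A -> computable k B ->
  computable k (fun v => pair_code (A v) (B v)).
Proof.
apply: computable_app2; rewrite /pair_code.
by repeat (comp_step || apply: computable_trunc_log).
Qed.

Lemma computable_decode_pair (g : nat -> nat -> nat) :
  computable 2 (fun v => g (var 0 v) (var 1 v)) ->
  computable 1 (fun v => decode_pair g (var 0 v)).
Proof.
move=> cg; rewrite /decode_pair.
by repeat (apply: computable_pair_code || apply: (computable_app2 (f := g) cg)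
  || comp_step).
Qed.

(** On values [z < b] this is the lexicographic order by count and then by [z], so no two values are
    tied. *)
Definition popularity (cnt : nat -> nat) b z := cnt z * b + z.

Definition rank (cnt : nat -> nat) b z :=
  \sum_(0 <= z' < b) (popularity cnt b z < popularity cnt b z').

Definition unrank (cnt : nat -> nat) b i :=
  \sum_(0 <= z < b) (rank cnt b z == i) * z.

Lemma computable_unrank (cnt : nat -> nat -> nat) (b : nat -> nat) :
  computable 2 (fun v => cnt (var 0 v) (var 1 v)) ->
  computable 1 (fun v => b (var 0 v)) ->
  computable 2 (fun v => unrank (cnt (var 0 v)) (b (var 0 v)) (var 1 v)).
Proof.
move=> cc cb; rewrite /unrank /rank /popularity.
by repeat (apply: (computable_app2 (f := cnt) cc)
  || apply: (computable_app1 (f := b) cb) || comp_step).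
Qed.

Section Rank.
Variables (cnt : nat -> nat) (b : nat).
Notation popularity := (popularity cnt b).
Notation rank := (rank cnt b).

Lemma rank_card z : rank z = #|[set u : 'I_b | popularity z < popularity u]|.
Proof.
rewrite /rank big_mkord -sum1_card big_mkcond /=.
by rewrite [RHS]big_mkcond; apply: eq_bigr => u _; rewrite inE; case: ifP.
Qed.

Lemma leq_rank z z' : popularity z <= popularity z' -> rank z' <= rank z.
Proof.
move=> le_zz'; rewrite !rank_card subset_leq_card //.
by apply/subsetP => u; rewrite !inE; apply: leq_ltn_trans.
Qed.

Lemma ltn_rank z z' : z' < b -> popularity z < popularity z' -> rank z' < rank z.
Proof.
move=> lt_z'b lt_zz'; rewrite !rank_card proper_card //; apply/properP; split.
  by apply/subsetP => u; rewrite !inE; apply: ltn_trans.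
by exists (Ordinal lt_z'b); rewrite !inE //= ltnn.
Qed.

Lemma rank_ltn z : z < b -> rank z < b.
Proof.
move=> lt_zb; rewrite rank_card -[X in _ < X](card_ord b) -cardsT proper_card //.
by rewrite properT; apply/eqP => /setP/(_ (Ordinal lt_zb)); rewrite !inE ltnn.
Qed.

Lemma rank_inj z z' : z < b -> z' < b -> rank z = rank z' -> z = z'.
Proof.
move=> lt_z lt_z' e.
case: (ltngtP (popularity z) (popularity z')) => [lt|lt|].
- by have := ltn_rank lt_z' lt; rewrite e ltnn.
- by have := ltn_rank lt_z lt; rewrite e ltnn.
- by case/divmod_inj.
Qed.

Lemma rankK z : z < b -> unrank cnt b (rank z) = z.
Proof.
move=> lt_z; rewrite /unrank big_mkord (bigD1 (Ordinal lt_z)) //= eqxx mul1n.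
rewrite big1 ?addn0 // => u ne_u; case: eqP => // /rank_inj e.
by rewrite -val_eqE /= e ?eqxx in ne_u.
Qed.

(** Ranks are distinct and less than [b], so ranking permutes the numbers below [b]. *)
Lemma card_rank_ltn s : s <= b -> #|[set z : 'I_b | rank z < s]| = s.
Proof.
move=> le_sb; pose r (z : 'I_b) := Ordinal (rank_ltn (ltn_ord z)).
have r_inj : injective r.
  by move=> z z' [/rank_inj e]; apply/val_inj/e.
have [r' rK r'K] := injF_bij r_inj.
have -> : [set z : 'I_b | rank z < s] = r @^-1: [set j : 'I_b | j < s].
  by apply/setP => z; rewrite !inE.
rewrite on_card_preimset; last by exists r' => z _; [apply: rK|apply: r'K].
rewrite -sum1_card; under eq_bigl do rewrite inE.
by rewrite -(big_ord_widen _ (fun=> 1) le_sb) sum1_card card_ord.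
Qed.

End Rank.

(* Every value of rank at least [s] has at most as many preimages as each of the
   [s] values of rank less than [s]. *)
Lemma popular_values (I : finType) (g : I -> nat) (cnt : nat -> nat) b lo M s q :
    (forall z, cnt z = #|[set x | g x == z]|) ->
    (forall x, g x < b) -> (forall x, lo <= g x < lo + M) ->
    0 < s <= b -> M = s * q ->
  #|I| <= q.+1 * #|[set x | rank cnt b (g x) < s]|.
Proof.
move=> cntE g_b g_lo /andP[s_gt0 s_b] ME; set P := [set x | _].
have PE : #|P| = \sum_(z : 'I_b | rank cnt b z < s) cnt z.
  pose g' x := Ordinal (g_b x).
  rewrite -sum1_card.
  rewrite (partition_big g' (fun z : 'I_b => rank cnt b z < s)) /=; last first.
    by move=> x; rewrite inE.
  apply: eq_bigr => z lt_zs; rewrite cntE -sum1_card; apply: eq_bigl => x.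
  by rewrite !inE -val_eqE /=; case: eqP => [->|]; rewrite ?lt_zs ?andbF.
(* A fibre over a value outside the top [s] is no larger than any of the [s] top fibres, whose sizes
   add up to [#|P|]. *)
have block_le (A : {set I}) x0 :
    x0 \notin P -> (forall x, x \in A -> g x = g x0) -> s * #|A| <= #|P|.
  rewrite inE -leqNgt => rk_x0 gA.
  rewrite -[X in X * _](card_rank_ltn cnt s_b) PE -sum1_card big_distrl /=.
  under eq_bigl do rewrite inE.
  apply: leq_sum => z lt_zs; rewrite mul1n.
  apply: (@leq_trans (cnt (g x0))).
    rewrite cntE subset_leq_card //; apply/subsetP => x /gA.
    by rewrite inE => ->.
  have : popularity cnt b (g x0) < popularity cnt b z.
    rewrite ltnNge; apply: contraL lt_zs => /leq_rank le.
    by rewrite -leqNgt (leq_trans rk_x0).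
  have := ltn_ord z; have := g_b x0; rewrite /popularity.
  (* A smaller count would force a smaller popularity, because both values are below [b]. *)
  by case: (leqP (cnt (g x0)) (cnt z)) => //; nia.
have g_M x : g x - lo < M by have := g_lo x; lia.
(* The values of [g] lie in an interval of length [M], so the complement of [P] splits into at most
   [M] fibres, each bounded by [block_le]. *)
have compl_le : s * #|~: P| <= M * #|P|.
  rewrite -sum1_card (partition_big (fun x => Ordinal (g_M x)) xpredT) //=.
  rewrite big_distrr /= -[X in _ <= X * _](card_ord M) -sum_nat_const.
  apply: leq_sum => w _; rewrite sum1dep_card.
  case: (set_0Vmem [set x | (x \in ~: P) && (Ordinal (g_M x) == w)]) => [->|[x0]].
    by rewrite cards0 muln0.
  rewrite !inE => /andP[x0P /eqP ew]; apply: (block_le _ x0); first by rewrite inE.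
  move=> x; rewrite inE => /andP[_]; rewrite -ew -val_eqE /= => /eqP.
  by have := g_lo x; have := g_lo x0; lia.
rewrite -(cardsC P) mulSn leq_add2l.
by rewrite -(leq_pmul2l s_gt0) (leq_trans compl_le) // ME mulnA.
Qed.

(** * Popular values of an ensemble *)

Lemma nat_of_string_bounds s :
  2 ^ size s <= (nat_of_string s).+1 < 2 ^ (size s).+1.
Proof.
elim: s => [|b s] //=; rewrite !expnS; set p := 2 ^ size s.
by case: b => /=; lia.
Qed.

(** Strings of length [n] are numbered from [2 ^ n - 1] to [2 ^ n.+1 - 2], and [a] is an offset in
    that interval; the constant string is a dummy for larger [a]. *)
Definition nth_tuple n a : n.-tuple bool :=
  odflt [tuple of nseq n false]
    [pick s : n.-tuple bool | nat_of_string s == (2 ^ n).-1 + a].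

Lemma nth_tupleE n a :
  a < 2 ^ n -> nat_of_string (nth_tuple n a) = (2 ^ n).-1 + a.
Proof.
move=> lt_a; rewrite /nth_tuple; case: pickP => [s /eqP //|noS].
have [s es] := nat_of_string_surj ((2 ^ n).-1 + a).
have n0 : 0 < 2 ^ n by rewrite expn_gt0.
have /andP[lo hi] := nat_of_string_bounds s; rewrite es in lo hi.
suff szs : size s == n by have := noS (Tuple szs); rewrite es eqxx.
rewrite eqn_leq; apply/andP; split.
  rewrite -ltnS -(ltn_exp2l _ _ (isT : 1 < 2)); apply: leq_ltn_trans lo _.
  by rewrite expnS; lia.
rewrite -ltnS -(ltn_exp2l _ _ (isT : 1 < 2)); apply: leq_ltn_trans hi.
by lia.
Qed.

Lemma nth_tuple_inj n : injective (fun a : 'I_(2 ^ n) => nth_tuple n a).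
Proof.
move=> a a' /(congr1 (fun s : n.-tuple bool => nat_of_string s)).
by rewrite !nth_tupleE // => /addnI/val_inj.
Qed.

Section Ensemble.
Variables (m : nat -> nat)
  (f : forall n, n.-tuple bool -> n.-tuple bool -> (m n).-tuple bool).

(* Truncating the indices makes this total in [a] and [b]. *)
Definition ensemble_nat n a b :=
  let t c := nth_tuple n (minn c (2 ^ n).-1) in nat_of_string (f (t a) (t b)).

Definition ensemble_count n z :=
  \sum_(0 <= a < 2 ^ n) \sum_(0 <= b < 2 ^ n) (ensemble_nat n a b == z).

(** No code for [m] is at hand, so the bound is computed from one value of [f]: that value is at
    least [2 ^ m n - 1], while all values are below [2 ^ (m n).+1 - 1]. *)
Definition ensemble_bound n := (ensemble_nat n 0 0 + ensemble_nat n 0 0).+3.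

Lemma computable_ensemble_nat : computable_ensemble f ->
  computable 3 (fun v => ensemble_nat (var 0 v) (var 1 v) (var 2 v)).
Proof.
move=> [c cf].
pose t i v := (2 ^ var 0 v).-1 + minn (var i v) (2 ^ var 0 v).-1.
have ct i : i < 3 -> computable 3 (t i).
  move=> i3; apply: (@eq_computable _ (fun v =>
      (2 ^ var 0 v).-1 + (var i v - (var i v - (2 ^ var 0 v).-1)))).
    by move=> v _; rewrite /t minnE.
  by repeat (comp_step || apply: computable_pred).
have [|c' c'P] := @eval_comp 3 3 c [:: var 0; t 1; t 2] erefl.
  by case=> [|[|[|]]] //= _; [apply: computable_var|apply: ct|apply: ct].
exists c' => v; set s1 := nth_tuple (var 0 v) (minn (var 1 v) (2 ^ var 0 v).-1).
set s2 := nth_tuple (var 0 v) (minn (var 2 v) (2 ^ var 0 v).-1).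
apply: c'P (cf _ s1 s2) => /=; congr [:: _; _; _].
- by rewrite nth_tupleE // -[X in _ < X]prednK ?expn_gt0 // ltnS geq_minr.
- by rewrite nth_tupleE // -[X in _ < X]prednK ?expn_gt0 // ltnS geq_minr.
Qed.

Lemma ensemble_natE n (a b : 'I_(2 ^ n)) :
  ensemble_nat n a b = nat_of_string (f (nth_tuple n a) (nth_tuple n b)).
Proof.
have le_pred (c : 'I_(2 ^ n)) : c <= (2 ^ n).-1.
  by rewrite -ltnS prednK ?expn_gt0.
by rewrite /ensemble_nat !(minn_idPl (le_pred _)).
Qed.

Lemma ensemble_nat_bounds n a b :
  (2 ^ m n).-1 <= ensemble_nat n a b < (2 ^ m n).-1 + 2 ^ m n.
Proof.
have := expn_gt0 2 (m n).
rewrite /ensemble_nat; set s := f _ _; have := nat_of_string_bounds s.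
by rewrite size_tuple expnS /=; lia.
Qed.

Lemma ensemble_countE n z : ensemble_count n z =
  #|[set p : 'I_(2 ^ n) * 'I_(2 ^ n) | ensemble_nat n p.1 p.2 == z]|.
Proof.
rewrite /ensemble_count big_mkord; under eq_bigr do rewrite big_mkord.
rewrite pair_big /= -sum1_card [RHS]big_mkcond.
by apply: eq_bigr => p _; rewrite inE; case: eqP.
Qed.

Lemma ensemble_bound_lt n a b : ensemble_nat n a b < ensemble_bound n.
Proof.
have := ensemble_nat_bounds n a b; have := ensemble_nat_bounds n 0 0.
by rewrite /ensemble_bound; have := expn_gt0 2 (m n); lia.
Qed.

(** Among [2 ^ m n] possible values, the top [2 ^ (m n - alpha)] are one in [2 ^ alpha], whence
    [q = 2 ^ alpha] in [popular_values]. *)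
Lemma ensemble_popular n alpha : alpha <= m n ->
  2 ^ n * 2 ^ n <= (2 ^ alpha).+1 *
    #|[set p : 'I_(2 ^ n) * 'I_(2 ^ n) |
        rank (ensemble_count n) (ensemble_bound n) (ensemble_nat n p.1 p.2)
          < 2 ^ (m n - alpha)]|.
Proof.
move=> le_am; rewrite -{1 2}[2 ^ n]card_ord -card_prod.
apply: (popular_values (lo := (2 ^ m n).-1) (M := 2 ^ m n)
  (g := fun p : 'I_(2 ^ n) * 'I_(2 ^ n) => ensemble_nat n p.1 p.2)).
- exact: ensemble_countE.
- by move=> p; apply: ensemble_bound_lt.
- by move=> p; apply: ensemble_nat_bounds.
- rewrite expn_gt0 /=; apply: (@leq_trans (2 ^ m n)).
    by rewrite leq_exp2l // leq_subr.
  have := ensemble_nat_bounds n 0 0; rewrite /ensemble_bound.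
  by have := expn_gt0 2 (m n); lia.
- by rewrite -expnD subnK.
Qed.

(** The decoder behind the upper bound on [C]: it reads [n] and a rank from [N]. *)
Definition nth_popular_value N :=
  decode_pair (fun n => unrank (ensemble_count n) (ensemble_bound n)) N.

Lemma computable_nth_popular_value : computable_ensemble f ->
  computable 1 (fun v => nth_popular_value (var 0 v)).
Proof.
move=> /computable_ensemble_nat cF; apply: computable_decode_pair.
apply: (computable_unrank (cnt := ensemble_count) (b := ensemble_bound)).
  rewrite /ensemble_count.
  by repeat (apply: (computable_app3 (f := ensemble_nat) cF) || comp_step).
rewrite /ensemble_bound.
by repeat (apply: (computable_app3 (f := ensemble_nat) cF) || comp_step).
Qed.

End Ensemble.

(** * Complexity bounds and the counting of programs *)

(** Every code defines a machine, to which universality applies. Halting is decided classically in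
    [M], and [c] itself witnesses that [M] is partial computable. *)
Lemma C_le_eval (U : universal_machine) (c : code 1) :
  exists k, forall p x, eval c [tuple nat_of_string p] (nat_of_string x) ->
    C U x <= size p + k.
Proof.
pose M p := if pselect (exists x, eval c [tuple nat_of_string p] (nat_of_string x))
  is left ex then Some (projT1 (cid ex)) else None.
have MP p x : M p = Some x <-> eval c [tuple nat_of_string p] (nat_of_string x).
  rewrite /M; case: pselect => [ex|nex]; last first.
    by split=> // ev; case: nex; exists x.
  case: (cid ex) => /= y ev; split=> [[<-] //|ev'].
  by rewrite (nat_of_string_inj (eval_det ev ev')).
have [|k kP] := @run_universal U M; first by exists c.
exists k => p x /MP/kP[q [Uq szq]]; apply: leq_trans szq.
rewrite /C; case: ex_minnP => j _ /(_ (size q)); apply.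
by apply/asboolP; exists q.
Qed.

Lemma Ccond_program (V : universal_cond_machine) x y :
  exists p, V p y = Some x /\ size p = Ccond V x y.
Proof. by rewrite /Ccond; case: ex_minnP => k /asboolP. Qed.

(** A program and a condition determine the output, so each counted [t] is recovered from the number
    of a shortest program and [Y t]. The factor [d] lowers the complexity threshold by [log d]
    without leaving the integers. *)
Lemma card_Ccond_lt (V : universal_cond_machine) (T S : finType)
    (X : T -> string) (Y : T -> S) (cond : S -> string) (d n : nat) :
    injective (fun t => (X t, Y t)) ->
  #|[set t | 2 ^ Ccond V (X t) (cond (Y t)) * d < 2 ^ n]| * d
    <= 2 ^ n.+1 * #|S|.
Proof.
move=> XY_inj; set B := [set t | _].
have [prog progP] := choice (fun t => Ccond_program V (X t) (cond (Y t))).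
have prog_lt t : t \in B -> (nat_of_string (prog t)).+1 * d <= 2 ^ n.+1.
  rewrite inE -(progP t).2 expnS.
  have /andP[_] := nat_of_string_bounds (prog t); rewrite expnS.
  by move=> lt_p lt_n; nia.
have [->|[t0 /prog_lt]] := set_0Vmem B; first by rewrite cards0.
have [->|d_gt0] := posnP d; first by rewrite !muln0.
(* All program numbers in question are below [q.+1]; the successor form is what [inord] requires,
   and the element [t0] of [B] makes the quotient positive. *)
rewrite -leq_divRL // => lt_Q; pose q := (2 ^ n.+1 %/ d).-1.
have qE : q.+1 = 2 ^ n.+1 %/ d by rewrite prednK // (leq_trans _ lt_Q).
pose phi t : 'I_q.+1 * S := (inord (nat_of_string (prog t)), Y t).
have phi_inj : {in B &, injective phi}.
  move=> t t' Bt Bt' [/(congr1 val) /= e eY]; apply: XY_inj; congr pair => //.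
  move: e; rewrite !inordK ?qE ?leq_divRL ?prog_lt // => /nat_of_string_inj e.
  have := (progP t).1; rewrite e eY (progP t').1 => -[].
  by [].
rewrite -(card_in_imset phi_inj).
have := max_card (mem (phi @: B)); rewrite card_prod card_ord => le_card.
apply: (leq_trans (leq_mul le_card (leqnn _))); rewrite [q.+1]qE.
by rewrite mulnAC leq_mul2r leq_trunc_div orbT.
Qed.

Lemma exists_popular_independent (V : universal_cond_machine) (m : nat -> nat)
    (f : forall n, n.-tuple bool -> n.-tuple bool -> (m n).-tuple bool)
    n alpha : 2 < n -> alpha <= m n ->
  exists a b : 'I_(2 ^ n),
    let x := nth_tuple n a in let y := nth_tuple n b in
    [/\ 2 ^ n <= 2 ^ Ccond V x y * (n ^ 2 * 2 ^ alpha),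
        2 ^ n <= 2 ^ Ccond V y x * (n ^ 2 * 2 ^ alpha)
      & rank (ensemble_count f n) (ensemble_bound f n) (ensemble_nat f n a b)
          < 2 ^ (m n - alpha)].
Proof.
move=> n_gt2 le_am; set d := n ^ 2 * 2 ^ alpha.
pose t (a : 'I_(2 ^ n)) : string := nth_tuple n a.
have t_inj : injective t by move=> a b /val_inj; apply: nth_tuple_inj.
have := ensemble_popular f le_am; set P := [set p | _] => P_large.
have inj1 : injective (fun p : 'I_(2 ^ n) * 'I_(2 ^ n) => (t p.1, p.2)).
  by move=> [a b] [a' b'] [] /t_inj /= -> ->.
have inj2 : injective (fun p : 'I_(2 ^ n) * 'I_(2 ^ n) => (t p.2, p.1)).
  by move=> [a b] [a' b'] [] /t_inj /= -> ->.
have := card_Ccond_lt V t d n inj1; set B1 := [set p | _] => B1_small.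
have := card_Ccond_lt V t d n inj2; set B2 := [set p | _] => B2_small.
have: ~~ (P \subset B1 :|: B2).
  apply/negP => /subset_leq_card le_P.
  have le_B := leq_trans le_P (leq_card_setU B1 B2).
  move: B1_small B2_small; rewrite card_ord expnS /d.
  have := expn_gt0 2 alpha; have := expn_gt0 2 n; move: P_large.
  set N := 2 ^ n; set A := 2 ^ alpha => P_large N0 A0.
  (* The two bad sets have together at most [4 * N * N / (9 * A)] elements, fewer than the
     [N * N / (A + 1)] popular pairs, because [A + 1 <= 2 * A]. *)
  have n2 : 9 <= n ^ 2 by rewrite -[9]/(3 ^ 2) leq_exp2r.
  move: #|P| #|B1| #|B2| le_B P_large => p b1 b2 le_B P_large hB1 hB2.
  have h1 : b1 * A * 9 <= 2 * N * N by apply: leq_trans hB1; nia.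
  have h2 : b2 * A * 9 <= 2 * N * N by apply: leq_trans hB2; nia.
  by nia.
case/subsetPn => -[a b]; rewrite !inE negb_or -!leqNgt => Pab /andP[c1 c2].
by exists a, b.
Qed.

(** The bounds of the theorem in exponential form, which keeps the argument in the integers; the
    case [2 ^ alpha <= n] is left to the trivial bound on [C]. *)
Lemma exists_simple_popular (U : universal_machine) (V : universal_cond_machine)
    (m : nat -> nat)
    (f : forall n, n.-tuple bool -> n.-tuple bool -> (m n).-tuple bool) :
    computable_ensemble f ->
  exists k, forall n alpha, 2 < n -> alpha <= m n -> exists x y : n.-tuple bool,
    [/\ 2 ^ n <= 2 ^ Ccond V x y * (n ^ 2 * 2 ^ alpha),
        2 ^ n <= 2 ^ Ccond V y x * (n ^ 2 * 2 ^ alpha)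
      & n < 2 ^ alpha ->
        2 ^ C U (f n x y) <= 2 ^ k * (alpha ^ 2 * n * 2 ^ (m n - alpha))].
Proof.
move=> /computable_nth_popular_value[c cP].
have [k kP] := C_le_eval U c.
(* The [3] pays for the factor 8 in [pair_code_bound], and [k] for simulating the decoder. *)
exists (3 + k) => n alpha n_gt2 le_am.
have [a [b [cxy cyx lt_rk]]] := exists_popular_independent V f n_gt2 le_am.
exists (nth_tuple n a), (nth_tuple n b); split=> // lt_n.
have n_gt0 : 0 < n by apply: leq_trans n_gt2.
set i := rank _ _ _ in lt_rk; have [p ep] := nat_of_string_surj (pair_code n i).
have := kP p (f n (nth_tuple n a) (nth_tuple n b)).
have := cP [tuple nat_of_string p]; rewrite /var /= ep.
rewrite /nth_popular_value decode_pairE rankK ?ensemble_bound_lt //.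
rewrite ensemble_natE => ev /(_ ev) le_C.
have /andP[le_p _] := nat_of_string_bounds p; rewrite ep in le_p.
have := leq_trans le_p (pair_code_bound i n_gt0).
(* The binary length of [n] is at most [alpha]; this is the source of the term [2 log alpha]. *)
have lt_k : (trunc_log 2 n) < alpha.
  by rewrite -(ltn_exp2l _ _ (isT : 1 < 2)) (leq_ltn_trans _ lt_n) // trunc_logP.
move=> {}le_p; apply: (@leq_trans (2 ^ (size p + k))); first by rewrite leq_exp2l.
rewrite !expnD mulnAC leq_mul2r; apply/orP; right.
apply: (@leq_trans (8 * alpha ^ 2 * n * 2 ^ (m n - alpha))); last first.
  by rewrite !mulnA.
apply: (leq_trans le_p); apply: leq_mul => //; apply: leq_mul => //.
by apply: leq_mul => //; rewrite leq_sqr.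
Qed.

(** The empty program has at most one output per condition. If it fails to copy some bit, that bit
    paired with itself works; if it copies both, the two distinct bits work. This serves the case
    [n = 1]. *)
Lemma exists_independent_bits (V : universal_cond_machine) :
  exists x y : 1.-tuple bool, 0 < Ccond V x y /\ 0 < Ccond V y x.
Proof.
have Ccond_gt0 (x y : string) : V [::] y != Some x -> 0 < Ccond V x y.
  move=> ne; case: (Ccond_program V x y) => p [Vp <-]; case: p Vp => // e.
  by rewrite e eqxx in ne.
pose bit b : 1.-tuple bool := [tuple b].
have [e0|/Ccond_gt0 gt0] := eqVneq (V [::] (bit false))
    (Some (tval (bit false))); last first.
  by exists (bit false), (bit false).
have [e1|/Ccond_gt0 gt1] := eqVneq (V [::] (bit true))
    (Some (tval (bit true))); last first.
  by exists (bit true), (bit true).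
by exists (bit false), (bit true); split; apply: Ccond_gt0; rewrite ?e0 ?e1.
Qed.

(** * Base-2 logarithms and the final estimates *)

Import Order.TTheory GRing.Theory Num.Theory.
Local Open Scope ring_scope.

Section Log2.
Variable R : realType.

Lemma ln2_gt0 : 0 < ln 2 :> R.
Proof. by rewrite ln_gt0 // ltr1n. Qed.

Lemma log2_exp k : log2 R (2 ^ k)%N = k%:R.
Proof.
rewrite /log2 natrX lnXn ?ltr0n // -[_ *+ k]mulr_natl.
by rewrite mulfK // gt_eqF // ln2_gt0.
Qed.

Lemma log2M a b : (0 < a)%N -> (0 < b)%N ->
  log2 R (a * b)%N = log2 R a + log2 R b.
Proof.
by move=> a0 b0; rewrite /log2 natrM lnM ?posrE ?ltr0n // mulrDl.
Qed.

Lemma ler_log2 a b : (0 < a)%N -> (a <= b)%N -> log2 R a <= log2 R b.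
Proof.
move=> a0 ab; rewrite /log2 ler_pM2r ?invr_gt0 ?ln2_gt0 //.
by rewrite ler_ln ?posrE ?ltr0n ?ler_nat // (leq_trans a0).
Qed.

Lemma log2_1 : log2 R 1%N = 0.
Proof. exact: (log2_exp 0). Qed.

Lemma log2_ge0 a : 0 <= log2 R a.
Proof.
case: a => [|a]; first by rewrite /log2 ln0 // mul0r.
by rewrite -log2_1; apply: ler_log2.
Qed.

Lemma sub_log2_le n alpha k : (0 < n)%N ->
  (2 ^ n <= 2 ^ k * (n ^ 2 * 2 ^ alpha))%N ->
  n%:R - alpha%:R - 2 * log2 R n <= k%:R.
Proof.
move=> n0; move/ler_log2; rewrite expn_gt0 => /(_ isT).
rewrite !log2M ?muln_gt0 ?expn_gt0 ?n0 // !log2_exp.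
by lra.
Qed.

End Log2.

Theorem theorem2 (R : realType) (U : universal_machine)
    (V : universal_cond_machine) (m : nat -> nat)
    (f : forall n, n.-tuple bool -> n.-tuple bool -> (m n).-tuple bool)
    (hf : computable_ensemble f) :
  exists c : R, forall n alpha : nat, (alpha <= m n)%N ->
    exists x y : n.-tuple bool,
      [/\ n%:R - alpha%:R - 2 * log2 R n <= (Ccond V x y)%:R,
          n%:R - alpha%:R - 2 * log2 R n <= (Ccond V y x)%:R
        & (C U (f n x y))%:R
            <= (m n)%:R - alpha%:R + log2 R n + 2 * log2 R alpha + c].
Proof.
(* The identity code bounds the complexity of a string by its length plus a constant. *)
have [k0 k0P] := C_le_eval U (Proj ord0).
have {}k0P n (x y : n.-tuple bool) : (C U (f n x y))%:R <= (m n)%:R + k0%:R :> R.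
  have ev : eval (Proj ord0) [tuple nat_of_string (f n x y)]
    (nat_of_string (f n x y)) by [].
  by rewrite -natrD ler_nat; have := k0P _ _ ev; rewrite size_tuple.
have [k1 k1P] := exists_simple_popular U V hf.
(* For [n <= 2] also [alpha] is at most [m3], so there the loss of [alpha] is absorbed in the
   constant. *)
have [m3 m3P] : exists m3, forall n, (n <= 2)%N -> (m n <= m3)%N.
  by exists (m 0 + m 1 + m 2)%N => -[|[|[|]]] // _; lia.
exists (k0 + k1 + m3)%:R => n alpha le_am.
have Ln := log2_ge0 R n; have La := log2_ge0 R alpha.
have := ler0n R k0; have := ler0n R k1; have := ler0n R m3.
rewrite !natrD => m3_0 k1_0 k0_0.
have [n_gt2|n_le2] := ltnP 2 n.
  have n_gt0 : (0 < n)%N by apply: ltn_trans n_gt2.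
  have [x [y [cxy cyx Cf]]] := k1P n alpha n_gt2 le_am.
  exists x, y; split; [exact: sub_log2_le|exact: sub_log2_le|].
  (* If [2 ^ alpha <= n], then [alpha <= log n] and the bound [m n + k0] is enough. *)
  have [/(@ler_log2 R _ _)|/[dup] lt_n /Cf/(@ler_log2 R _ _)]
    := leqP (2 ^ alpha) n.
    rewrite expn_gt0 log2_exp => /(_ isT).
    by have := k0P n x y; lra.
  have a_gt0 : (0 < alpha)%N by case: posnP lt_n => // ->; rewrite expn0; lia.
  rewrite expn_gt0 => /(_ isT).
  rewrite !log2M ?muln_gt0 ?expn_gt0 ?n_gt0 ?a_gt0 // !log2_exp.
  by rewrite natrB //; lra.
have Cf x y : (C U (f n x y))%:R
    <= (m n)%:R - alpha%:R + log2 R n + 2 * log2 R alpha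
       + (k0%:R + k1%:R + m3%:R).
  have : alpha%:R <= m3%:R :> R.
    by rewrite ler_nat (leq_trans le_am) ?m3P.
  by have := k0P n x y; lra.
(* A nonpositive lower bound holds for every pair. For [n <= 2] it can be positive only at [n = 1]:
   it equals [- alpha] both at [n = 0], where [log 0 = 0], and at [n = 2]. *)
have [trivial|] := leP (n%:R - alpha%:R - 2 * log2 R n) 0.
  exists [tuple of nseq n false], [tuple of nseq n false].
  by split; [apply: le_trans trivial _|apply: le_trans trivial _|apply: Cf].
case: n n_le2 {le_am Ln} Cf => [|[|[|]]] // _ Cf.
- by have := log2_ge0 R 0; have := ler0n R alpha; lra.
- move=> _; have [x [y [cxy cyx]]] := exists_independent_bits V.
  (* Here the lower bound is at most 1, so positive complexities suffice. *)
  have le1 : 1%:R - alpha%:R - 2 * log2 R 1 <= 1 :> R.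
    by have := ler0n R alpha; rewrite log2_1; lra.
  by exists x, y; split; rewrite ?(le_trans le1) ?ler1n //; apply: Cf.
- by rewrite (log2_exp R 1 : log2 R 2%N = 1); have := ler0n R alpha; lra.
Qed.
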